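(* Let $\epsilon>0$ and let $q$ be an odd prime power with $q\equiv 3\bmod 4$. Given $A,B\subset\mathbb{F}_q^2$ with $|A|\le|B|$ and $|B|^{1+\epsilon}<q^2/2$, there exists $E\subset O(2)$ with $$|E|\ll\frac{q|B|^{\epsilon}}{|A|^{1/2}}$$ such that for all $g\in O(2)\setminus E$ we have $$|A-gB|\gg|B|^{1+\epsilon}.$$
   Context: $\mathbb{F}_q$ is the finite field with $q$ elements. $O(2)$ is the group of $2\times 2$ orthogonal matrices over $\mathbb{F}_q$ (those preserving $\|x\|=x_1^2+x_2^2$). $A-gB=\{a-gb:a\in A,\ b\in B\}$. $X\ll Y$ (equivalently $Y\gg X$) means $X\le CY$ for an absolute constant $C>0$. *)

(* Defs.v *)
From HB Require Import structures.
From mathcomp Require Import all_boot all_order all_algebra all_fingroup finfield.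
From mathcomp Require Import ring.

Set Implicit Arguments.
Unset Strict Implicit.
Unset Printing Implicit Defensive.

Import GRing.Theory.
Local Open Scope ring_scope.

(* ||x|| = x_1 ^ 2 + x_2 ^ 2 is the quadratic form itself: no square root is
   involved. Vectors are columns, so that g x is g *m x. *)
Definition qnorm (F : finFieldType) (x : 'cV[F]_2) : F :=
  x ord0 ord0 ^+ 2 + x ord_max ord0 ^+ 2.

Definition O2 (F : finFieldType) : {set 'M[F]_2} :=
  [set g : 'M[F]_2 | [forall x : 'cV[F]_2, qnorm (g *m x) == qnorm x]].

Definition diffset (F : finFieldType) (A : {set 'cV[F]_2}) (g : 'M[F]_2)
    (B : {set 'cV[F]_2}) : {set 'cV[F]_2} :=
  [set a - g *m b | a in A, b in B].

Lemma odd_card_two_neq0 (F : finFieldType) : odd #|F| -> 2%:R != 0 :> F.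
Proof.
apply: contraL => /eqP two0.
have c2 : 2 \in [pchar F] by rewrite inE two0 eqxx.
rewrite (card_pprimeChar c2) oddX orbF; apply/negP => /eqP n0.
by have := finNzRing_gt1 F; rewrite (card_pprimeChar c2) n0.
Qed.

(* In odd characteristic, preserving ||.|| amounts to g^T g = 1. *)
Lemma O2E (F : finFieldType) (g : 'M[F]_2) :
  odd #|F| -> (g \in O2 F) = (g^T *m g == 1%:M).
Proof.
move=> /odd_card_two_neq0 two_neq0; rewrite inE.
have sum2 (f : 'I_2 -> F) : \sum_i f i = f ord0 + f ord_max.
  rewrite !big_ord_recr big_ord0 /= add0r.
  by congr (f _ + f _); apply: val_inj.
have gE i j : (g^T *m g) i j = g ord0 i * g ord0 j + g ord_max i * g ord_max j.
  by rewrite mxE sum2 !mxE.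
have qE (x : 'cV[F]_2) : qnorm (g *m x) =
    (g^T *m g) ord0 ord0 * x ord0 ord0 ^+ 2
    + (g^T *m g) ord_max ord_max * x ord_max ord0 ^+ 2
    + 2%:R * ((g^T *m g) ord0 ord_max * (x ord0 ord0 * x ord_max ord0)).
  by rewrite /qnorm !gE !mxE !sum2; ring.
apply/forallP/eqP => [gP | gP x]; last first.
  by rewrite qE gP !mxE /= mulr1n mulr0n !mul1r mul0r mulr0 addr0.
pose v a b : 'cV[F]_2 := \col_i (if i == ord0 then a else b).
have vP a b : qnorm (g *m v a b) = a ^+ 2 + b ^+ 2.
  by rewrite (eqP (gP _)) /qnorm !mxE.
have h00 : (g^T *m g) ord0 ord0 = 1.
  by have := vP 1 0; rewrite qE !mxE /= !(expr1n, expr0n, mulr0, mulr1, addr0).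
have h11 : (g^T *m g) ord_max ord_max = 1.
  have := vP 0 1; rewrite qE !mxE /=.
  by rewrite !(expr1n, expr0n, mul0r, mulr0, mulr1, addr0, add0r).
have h01 : (g^T *m g) ord0 ord_max = 0.
  have := vP 1 1; rewrite qE h00 h11 [v _ _ _ _]mxE [v _ _ ord_max _]mxE /=.
  rewrite !(expr1n, mulr1) => /eqP; rewrite -subr_eq0 addrAC subrr add0r.
  by rewrite mulf_eq0 (negPf two_neq0) => /eqP.
have h10 : (g^T *m g) ord_max ord0 = 0.
  by rewrite -h01 !gE; congr (_ + _); rewrite mulrC.
apply/matrixP => i j; rewrite [RHS]mxE.
have ordE (k : 'I_2) : k = ord0 \/ k = ord_max.
  by case: k => [[|[|//]]] k2; [left | right]; apply: val_inj.
by case: (ordE i) (ordE j) => -> [] ->.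
Qed.

(* Main.v *)
Require Import Defs.
From HB Require Import structures.
From mathcomp Require Import all_boot all_order all_algebra.
From mathcomp Require Import fingroup action finfield algC classfun character.
From mathcomp Require Import ring lra zify.
From mathcomp Require Import reals exp.

(** The exceptional set [E] consists of the [g] with [|A - gB| < N], where
    [N = |B|^(1 + eps)]. By Cauchy-Schwarz, the number [Q(g)] of coincidences
    [a - g b = a' - g b'] is then larger than [(|A||B|)^2 / N], hence, as
    [N < q^2 / 2], exceeds its expected value [(|A||B|)^2 / q^2] by at least
    [(|A||B|)^2 / (2 N)]. So it is enough to bound the total excess over [E].

    Fourier analysis on the plane, with a nontrivial additive character of the
    field, identifies the excess: [q^2 Q(g) - (|A||B|)^2] is the sum over
    [m != 0] of [|A^(m)|^2 |B^(g^T m)|^2] ([coincidences_fourier]). As [q] is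
    [3] mod [4], the quadratic form is anisotropic, and for [m != 0] there are at
    most two [g] with [g^T m = m'], none unless [m] and [m'] lie on the same
    circle ([card_O2_fiber_le2]). Summing over [g], the total excess is at most
    twice the sum over [m'] of [|B^(m')|^2] times the sum of [|A^(m)|^2] over the
    circle through [m'].

    The decisive input is a restriction estimate: the sum of [|A^(m)|^2] over a
    circle is at most [sqrt 3 * q * |A|^(3/2)] ([restriction]). By duality it
    amounts to an L^2 to L^4 bound for exponential sums with frequencies on the
    circle ([extension_L4]), and this holds because two points of a circle are
    determined by their sum, up to order and unless they are antipodal
    ([few_coincidences_circle]). With Parseval for [B], the total excess is
    [O(q^3 |A|^(3/2) |B|)] ([excess_coincidences_le]), and comparison with the
    lower bound [|E| q^2 (|A||B|)^2 / (2 N)] gives the bound on [|E|]. *)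

Set Implicit Arguments.
Unset Strict Implicit.
Unset Printing Implicit Defensive.

Import Order.TTheory GRing.Theory Num.Theory.
Local Open Scope ring_scope.

(** * Cauchy-Schwarz and weighted additive energy *)

(** Lagrange's identity: twice the difference of the two sides is the sum of
    the squares [(a i * b j - a j * b i) ^+ 2]. *)
Lemma sum_mul_sqr_le (K : numDomainType) (I : finType) (P : pred I)
    (a b : I -> K) :
    (forall i, a i \is Num.real) -> (forall i, b i \is Num.real) ->
  (\sum_(i | P i) a i * b i) ^+ 2 <=
  (\sum_(i | P i) a i ^+ 2) * (\sum_(i | P i) b i ^+ 2).
Proof.
move=> aR bR; rewrite -subr_ge0 -(pmulrn_lge0 _ (ltn0Sn 1)).
have -> : ((\sum_(i | P i) a i ^+ 2) * (\sum_(i | P i) b i ^+ 2)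
    - (\sum_(i | P i) a i * b i) ^+ 2) *+ 2
  = \sum_(i | P i) \sum_(j | P j) (a i * b j - a j * b i) ^+ 2.
  set X := \sum_(i | P i) a i ^+ 2; set Y := \sum_(i | P i) b i ^+ 2.
  set Z := \sum_(i | P i) a i * b i.
  have -> : (X * Y - Z ^+ 2) *+ 2 = X * Y + Y * X - (Z * Z + Z * Z) by ring.
  rewrite !big_distrlr -!big_split -sumrB /=; apply: eq_bigr => i _.
  by rewrite -!big_split -sumrB /=; apply: eq_bigr => j _; ring.
apply: sumr_ge0 => i _; apply: sumr_ge0 => j _.
by rewrite real_exprn_even_ge0 // rpredB ?rpredM.
Qed.

(** The property of a circle that drives the restriction estimate: two points
    of [S] are determined, up to order, by their sum, unless this sum is [0]. *)
Definition few_coincidences (V : finZmodType) (S : {set V}) :=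
  {in S & S, forall x y, {in S & S, forall x' y', x + y = x' + y' ->
    [\/ x' = x /\ y' = y, x' = y /\ y' = x | x + y = 0 /\ x' + y' = 0]}}.

(** The three ways in which [x + y = x' + y'] can hold contribute [X ^+ 2],
    [X ^+ 2] and, for the antipodal pairs, [(\sum_x w x * w (- x)) ^+ 2], which
    Cauchy-Schwarz bounds by [X ^+ 2] again; here [X] is the sum of the
    [w x ^+ 2]. *)
Lemma additive_energy_le (K : numDomainType) (V : finZmodType)
    (S : {set V}) (w : V -> K) :
    few_coincidences S -> (forall x, 0 <= w x) ->
    (forall x, x \notin S -> w x = 0) ->
  \sum_p \sum_q (p.1 + p.2 == q.1 + q.2)%:R * (w p.1 * w p.2 * (w q.1 * w q.2))
    <= 3 * (\sum_x w x ^+ 2) ^+ 2.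
Proof.
move=> fewS w_ge0 wS; pose X := \sum_x w x ^+ 2; rewrite -/X.
have X2E : X ^+ 2 = \sum_p (w p.1 * w p.2) ^+ 2.
  rewrite expr2 big_distrlr pair_big /=.
  by apply: eq_bigr => p _; rewrite exprMn.
pose u (p : V * V) := w p.1 * w p.2.
have u_ge0 p : 0 <= u p by rewrite mulr_ge0.
apply: (@le_trans _ _ (\sum_p \sum_q
   ((q == p)%:R * (u p * u q) + (q == (p.2, p.1))%:R * (u p * u q)
   + ((p.1 + p.2 == 0)%:R * u p) * ((q.1 + q.2 == 0)%:R * u q)))).
  apply: ler_sum => -[x y] _; apply: ler_sum => -[x' y'] _ /=.
  rewrite [_ * u (x, y) * _]mulrACA -natrM mulnb -!mulrDl -!natrD.
  have [eq_s|_] := eqVneq (x + y) (x' + y'); last first.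
    by rewrite mul0r mulr_ge0 ?ler0n ?mulr_ge0.
  have [/and4P[xS yS x'S y'S]|notS] := boolP
    [&& x \in S, y \in S, x' \in S & y' \in S].
    apply: ler_wpM2r; first by rewrite !mulr_ge0.
    rewrite ler_nat; case: (fewS x y xS yS x' y' x'S y'S eq_s).
    - by case=> -> ->; rewrite eqxx.
    - by case=> -> ->; rewrite eqxx addn1.
    - by case=> -> ->; rewrite eqxx addn1.
  suff -> : w x * w y * (w x' * w y') = 0.
    by rewrite mulr0 mulr_ge0 ?ler0n ?mulr_ge0.
  by move: notS; rewrite !negb_and => /or4P[] /wS ->; rewrite ?(mul0r, mulr0).
have -> : \sum_p \sum_q
   ((q == p)%:R * (u p * u q) + (q == (p.2, p.1))%:R * (u p * u q)
   + ((p.1 + p.2 == 0)%:R * u p) * ((q.1 + q.2 == 0)%:R * u q))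
  = X ^+ 2 + X ^+ 2 + (\sum_x w x * w (- x)) ^+ 2.
  under eq_bigr do rewrite !big_split /=.
  rewrite !big_split /=; congr (_ + _ + _).
  - rewrite X2E; apply: eq_bigr => p _; rewrite (bigD1 p) //= big1 => [|q qp].
      by rewrite eqxx mul1r addr0 expr2.
    by rewrite (negPf qp) mul0r.
  - rewrite X2E; apply: eq_bigr => p _.
    rewrite (bigD1 (p.2, p.1)) //= big1 => [|q qp].
      by rewrite eqxx mul1r addr0 /u /= [w p.2 * _]mulrC expr2.
    by rewrite (negPf qp) mul0r.
  rewrite -big_distrlr /= expr2.
  suff -> : \sum_i (i.1 + i.2 == 0)%:R * u i = \sum_x w x * w (- x) by [].
  rewrite -(pair_big xpredT xpredT (fun x y => (x + y == 0)%:R * u (x, y))) /=.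
  apply: eq_bigr => x _; rewrite (bigD1 (- x)) //= big1 => [|y yx].
    by rewrite subrr eqxx mul1r addr0.
  by rewrite addrC addr_eq0 (negPf yx) mul0r.
have -> : 3 * X ^+ 2 = X ^+ 2 + X ^+ 2 + X * X by ring.
rewrite lerD2l; apply: le_trans (sum_mul_sqr_le _ _ _) _ => [x|x|].
- exact: ger0_real.
- exact: ger0_real.
by rewrite -/X [X in _ <= _ * X](reindex_inj oppr_inj).
Qed.

(** * Additive characters and the dot product *)

Definition additive_character (F : finFieldType) (psi : F -> algC) :=
  [/\ forall x y, psi (x + y) = psi x * psi y,
      forall x, `|psi x| = 1
    & exists z, psi z != 1].

(** The additive group of [F] is abelian, so its irreducible characters are
    linear and there are [#|F| > 1] of them; any one other than the principal
    character will do. *)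
Lemma additive_character_exists (F : finFieldType) :
  exists psi : F -> algC, additive_character psi.
Proof.
have abF : abelian [set: F] by exact: FinRing.zmod_abelian.
have [i i_neq0] : exists i : Iirr [set: F], i != 0.
  have N_gt1 : (1 < Nirr [set: F])%N.
    rewrite NirrE; move: abF; rewrite card_classes_abelian => /eqP ->.
    by rewrite cardsT finNzRing_gt1.
  by exists (Ordinal N_gt1).
have lin_i : 'chi_i \is a linear_char by apply/char_abelianP.
exists (fun x => 'chi_i x); split=> [x y|x|].
- by rewrite -FinRing.zmodMgE lin_charM ?inE.
- by rewrite normC_lin_char ?inE.
- apply/existsP; apply: contraNT i_neq0 => /existsPn chi1.
  apply/eqP/irr_inj; rewrite irr0; apply/cfun_inP => x _.
  by rewrite cfun1E inE; apply/eqP; have := chi1 x; rewrite negbK.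
Qed.

Definition dot (F : finFieldType) n (x y : 'cV[F]_n) : F := (x^T *m y) 0 0.

Lemma dotE (F : finFieldType) n (x y : 'cV[F]_n) :
  dot x y = \sum_i x i 0 * y i 0.
Proof. by rewrite /dot mxE; apply: eq_bigr => i _; rewrite mxE. Qed.

Lemma dotC (F : finFieldType) n (x y : 'cV[F]_n) : dot x y = dot y x.
Proof. by rewrite !dotE; apply: eq_bigr => i _; rewrite mulrC. Qed.

Lemma dotDl (F : finFieldType) n (x y z : 'cV[F]_n) :
  dot (x + y) z = dot x z + dot y z.
Proof. by rewrite /dot linearD /= mulmxDl mxE. Qed.

Lemma dotDr (F : finFieldType) n (x y z : 'cV[F]_n) :
  dot z (x + y) = dot z x + dot z y.
Proof. by rewrite /dot mulmxDr mxE. Qed.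

Lemma dotNl (F : finFieldType) n (x y : 'cV[F]_n) : dot (- x) y = - dot x y.
Proof. by rewrite /dot linearN /= mulNmx mxE. Qed.

Lemma dotNr (F : finFieldType) n (x y : 'cV[F]_n) : dot x (- y) = - dot x y.
Proof. by rewrite /dot mulmxN mxE. Qed.

Lemma dot0l (F : finFieldType) n (x : 'cV[F]_n) : dot 0 x = 0.
Proof. by rewrite /dot trmx0 mul0mx mxE. Qed.

(** Moves a rotation from the points of a set onto the frequencies. *)
Lemma dot_mulmx (F : finFieldType) n (g : 'M[F]_n) (x y : 'cV[F]_n) :
  dot x (g *m y) = dot (g^T *m x) y.
Proof. by rewrite /dot trmx_mul trmxK mulmxA. Qed.

Lemma dot_surj (F : finFieldType) n (v : 'cV[F]_n) (z : F) :
  v != 0 -> exists w, dot v w = z.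
Proof.
move=> v_neq0; have [i vi] : exists i, v i 0 != 0.
  apply/existsP; apply: contraNT v_neq0 => /existsPn v0.
  apply/eqP/colP => i; rewrite mxE; apply/eqP.
  by have := v0 i; rewrite negbK.
exists ((z / v i 0) *: delta_mx i 0); rewrite dotE.
rewrite (bigD1 i) //= big1 => [|j ji].
  by rewrite !mxE !eqxx mulr1 addr0 mulrC divfK.
by rewrite !mxE (negPf ji) !mulr0.
Qed.

(** * Parseval and the restriction estimate *)

Section Fourier.

Variables (F : finFieldType) (psi : F -> algC).
Hypothesis psiP : additive_character psi.
Variable n : nat.
Implicit Types x y m : 'cV[F]_n.

Lemma additive_character0 : psi 0 = 1.
Proof.
have [psiD psi1 _] := psiP; have /eqP := psiD 0 0.
rewrite addr0 -{1}[psi 0]mulr1 eq_sym (inj_eq (mulfI _)) => [/eqP //|].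
by rewrite -normr_eq0 psi1 oner_eq0.
Qed.

Lemma additive_characterN z : psi (- z) = (psi z)^*.
Proof.
have [psiD psi1 _] := psiP.
have psi_neq0 : psi z != 0 by rewrite -normr_eq0 psi1 oner_eq0.
apply: (mulfI psi_neq0); rewrite -psiD subrr additive_character0 -normCK psi1.
by rewrite expr1n.
Qed.

(** Orthogonality: for [m != 0] a translation of [x] multiplies the sum by a
    value of [psi] other than [1], hence the sum vanishes. *)
Lemma sum_character_dot m :
  \sum_x psi (dot m x) = (m == 0)%:R * #|{: 'cV[F]_n}|%:R.
Proof.
have [psiD _ [z psiz]] := psiP; have [->|m_neq0] := eqVneq m 0.
  under eq_bigr do rewrite dot0l additive_character0.
  by rewrite sumr_const mul1r.
have [w mw] := dot_surj z m_neq0; rewrite mul0r.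
set S := (X in X = _).
have : S * (psi z - 1) = 0.
  rewrite mulrBr mulr1 [X in X - _](_ : _ = S) ?subrr //.
  rewrite [RHS](reindex_inj (addIr w)) mulr_suml /=.
  by apply: eq_bigr => x _; rewrite dotDr psiD mw.
by move/eqP; rewrite mulf_eq0 subr_eq0 (negPf psiz) orbF => /eqP.
Qed.

(** The frequencies [v i] may repeat: the diagonal of the usual Parseval
    identity is then replaced by the coincidences [v i = v j]. The same identity
    thus serves for a set, for a pair of sets and for the square of a sum. *)
Lemma parseval (I : finType) (P : pred I) (c : I -> algC) (v : I -> 'cV[F]_n) :
  \sum_x `|\sum_(i | P i) c i * psi (dot (v i) x)| ^+ 2 =
  #|{: 'cV[F]_n}|%:R *
    \sum_(i | P i) \sum_(j | P j) (v i == v j)%:R * (c i * (c j)^*).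
Proof.
have [psiD _ _] := psiP.
under eq_bigr do rewrite normCK rmorph_sum big_distrlr /=.
rewrite exchange_big mulr_sumr /=; apply: eq_bigr => i _.
rewrite exchange_big mulr_sumr /=; apply: eq_bigr => j _.
rewrite [RHS]mulrA [X in X * _]mulrC -subr_eq0 -sum_character_dot mulr_suml.
apply: eq_bigr => x _; rewrite dotDl dotNl psiD additive_characterN rmorphM.
by rewrite mulrACA mulrC.
Qed.

Definition exp_sum (A : {set 'cV[F]_n}) m : algC :=
  \sum_(a in A) psi (dot m a).

Lemma exp_sum_parseval A :
  \sum_m `|exp_sum A m| ^+ 2 = (#|{: 'cV[F]_n}| * #|A|)%:R.
Proof.
have -> : \sum_m `|exp_sum A m| ^+ 2 =
    \sum_x `|\sum_(a in A) 1 * psi (dot a x)| ^+ 2.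
  apply: eq_bigr => m _; congr (`|_| ^+ 2); apply: eq_bigr => a _.
  by rewrite mul1r dotC.
rewrite parseval natrM; congr (_ * _).
rewrite -sum1_card natr_sum; apply: eq_bigr => a aA.
rewrite (bigD1 a) //= big1 => [|b /andP[_ ba]].
  by rewrite eqxx conjC1 !mulr1 addr0.
by rewrite eq_sym (negPf ba) mul0r.
Qed.

(** The square of the exponential sum is an exponential sum over pairs, with
    frequencies [p.1 + p.2]; Parseval turns its mean square into a weighted
    additive energy. *)
Lemma extension_L4 (S : {set 'cV[F]_n}) (f : 'cV[F]_n -> algC) :
    few_coincidences S -> (forall x, x \notin S -> f x = 0) ->
  \sum_x `|\sum_m f m * psi (dot m x)| ^+ 4 <=
  #|{: 'cV[F]_n}|%:R * (3 * (\sum_m `|f m| ^+ 2) ^+ 2).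
Proof.
move=> fewS fS; have [psiD _ _] := psiP.
pose c (p : 'cV[F]_n * 'cV[F]_n) := f p.1 * f p.2.
have -> : \sum_x `|\sum_m f m * psi (dot m x)| ^+ 4 =
    \sum_x `|\sum_p c p * psi (dot (p.1 + p.2) x)| ^+ 2.
  apply: eq_bigr => x _; rewrite -[4%N]/(2 * 2)%N exprM -normrX.
  congr (`|_| ^+ 2).
  rewrite expr2 big_distrlr pair_big /=; apply: eq_bigr => p _.
  by rewrite dotDl psiD mulrACA.
rewrite parseval ler_wpM2l ?ler0n //.
apply: le_trans (additive_energy_le fewS (w := fun x => `|f x|) _ _);
  last first.
- by move=> x /fS ->; rewrite normr0.
- by move=> x; rewrite normr_ge0.
set E := (X in X <= _).
have E_ge0 : 0 <= E.
  rewrite -(pmulr_rge0 _ (_ : 0 < #|{: 'cV[F]_n}|%:R)) ?ltr0n; last first.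
    by apply/card_gt0P; exists 0.
  by rewrite -parseval sumr_ge0 // => x _; rewrite exprn_ge0.
rewrite -(ger0_norm E_ge0).
apply: le_trans (ler_norm_sum _ _ _) _; apply: ler_sum => p _.
apply: le_trans (ler_norm_sum _ _ _) _; apply: ler_sum => q _.
by rewrite /c !normrM norm_conjC normrM normr_nat.
Qed.

(** Duality. With [X] the left-hand sum before squaring, let [h] be the
    exponential sum with coefficients the conjugates of [exp_sum A m], [m] in
    [S]. Then [X] is the sum of [h] over [A]. Two applications of Cauchy-Schwarz
    bound [X ^+ 4] by [#|A| ^ 3] times the sum of the [`|h x| ^+ 4], which is at
    most [3 * #|V| * X ^+ 2] for [V] the whole space; divide by [X ^+ 2]. *)
Lemma restriction (S A : {set 'cV[F]_n}) :
    few_coincidences S ->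
  (\sum_(m in S) `|exp_sum A m| ^+ 2) ^+ 2 <=
  (3 * #|{: 'cV[F]_n}| * #|A| ^ 3)%:R.
Proof.
move=> fewS; set X := \sum_(m in S) _.
have X_ge0 : 0 <= X by rewrite sumr_ge0 // => x _; rewrite exprn_ge0.
pose f m := if m \in S then (exp_sum A m)^* else 0.
pose h x := \sum_m f m * psi (dot m x).
have fS m : m \notin S -> f m = 0 by rewrite /f => /negPf ->.
have XE : X = \sum_m `|f m| ^+ 2.
  rewrite /X big_mkcond; apply: eq_bigr => m _; rewrite /f.
  by case: ifP => _; rewrite ?norm_conjC // normr0 expr0n.
have XhE : X = \sum_(a in A) h a.
  rewrite exchange_big /= /X big_mkcond; apply: eq_bigr => m _.
  rewrite -mulr_sumr /f; case: ifP => _; last by rewrite mul0r.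
  by rewrite normCK mulrC.
have h4 := extension_L4 fewS fS; rewrite -XE -/h in h4.
pose Y := \sum_(a in A) `|h a| ^+ 2.
have Y_ge0 : 0 <= Y by rewrite sumr_ge0 // => x _; rewrite exprn_ge0.
have X2 : X ^+ 2 <= #|A|%:R * Y.
  apply: (@le_trans _ _ ((\sum_(a in A) 1 * `|h a|) ^+ 2)).
    rewrite lerXn2r ?nnegrE // ?sumr_ge0 //; first by move=> a _; rewrite mul1r.
    rewrite -(ger0_norm X_ge0) XhE; under [leRHS]eq_bigr do rewrite mul1r.
    exact: ler_norm_sum.
  apply: le_trans (sum_mul_sqr_le _ _ _) _ => [a|a|].
  - exact: rpred1.
  - exact: normr_real.
  under eq_bigr do rewrite expr1n.
  by rewrite sumr_const.
have Y2 : Y ^+ 2 <= #|A|%:R * \sum_x `|h x| ^+ 4.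
  rewrite /Y; under eq_bigr do rewrite -[_ ^+ 2]mul1r.
  apply: le_trans (sum_mul_sqr_le _ _ _) _ => [a|a|].
  - exact: rpred1.
  - by rewrite ger0_real // exprn_ge0.
  under eq_bigr do rewrite expr1n.
  rewrite sumr_const ler_wpM2l ?ler0n // [leRHS](bigID (mem A)) /=.
  under [leLHS]eq_bigr do rewrite -exprM.
  by rewrite lerDl sumr_ge0 // => x _; rewrite exprn_ge0.
have [->|X_neq0] := eqVneq X 0; first by rewrite expr0n ler0n.
have X_gt0 : 0 < X by rewrite lt_neqAle eq_sym X_neq0.
rewrite -(ler_pM2l (exprn_gt0 2 X_gt0)).
apply: (@le_trans _ _ ((#|A|%:R * Y) ^+ 2)).
  rewrite -expr2 lerXn2r ?nnegrE ?exprn_ge0 // mulr_ge0 ?ler0n //.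
rewrite exprMn.
apply: (@le_trans _ _ (#|A|%:R ^+ 2 *
    (#|A|%:R * (#|{: 'cV[F]_n}|%:R * (3 * X ^+ 2))))).
  rewrite ler_wpM2l ?exprn_ge0 ?ler0n //; apply: le_trans Y2 _.
  by rewrite ler_wpM2l ?ler0n.
rewrite le_eqVlt; apply/orP; left; apply/eqP.
by rewrite natrM natrX natrM; ring.
Qed.

End Fourier.

(** * The anisotropic plane and its orthogonal group *)

Lemma sum_ord2 (V : nmodType) (f : 'I_2 -> V) :
  \sum_i f i = f ord0 + f ord_max.
Proof.
rewrite !big_ord_recr big_ord0 /= add0r.
by congr (f _ + f _); apply: val_inj.
Qed.

Lemma col2P (F : finFieldType) (x y : 'cV[F]_2) :
  x ord0 ord0 = y ord0 ord0 -> x ord_max ord0 = y ord_max ord0 -> x = y.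
Proof.
move=> h0 h1; apply/colP => -[[|[|//]] k2].
  by rewrite (_ : Ordinal _ = ord0) //; apply: val_inj.
by rewrite (_ : Ordinal _ = ord_max) //; apply: val_inj.
Qed.

Lemma dot2E (F : finFieldType) (x y : 'cV[F]_2) :
  dot x y = x ord0 ord0 * y ord0 ord0 + x ord_max ord0 * y ord_max ord0.
Proof. by rewrite dotE sum_ord2. Qed.

(** Otherwise [x ^+ #|F| = x], with [#|F|] of the form [2 * k + 1] and [k] odd,
    would read [- x = x], so that [x = 0]. *)
Lemma sqr_neqN1 (F : finFieldType) (x : F) :
  #|F| = 3 %[mod 4] -> x ^+ 2 != -1.
Proof.
move=> F3; apply/eqP => x2.
have F_odd : odd #|F| by rewrite (divn_eq #|F| 4) F3 oddD oddM andbF.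
have := expf_card x.
have -> : #|F| = (2 * ((#|F| %/ 4).*2.+1)).+1 by lia.
rewrite exprS exprM x2 -signr_odd /= odd_double /= expr1 mulrN1 => /eqP.
rewrite eq_sym -addr_eq0 -mulr2n -mulr_natl mulf_eq0.
rewrite (negPf (odd_card_two_neq0 F_odd)) /= => /eqP x0.
by move/eqP: x2; rewrite x0 expr0n eq_sym oppr_eq0 oner_eq0.
Qed.

Definition anisotropic (F : finFieldType) :=
  forall x : 'cV[F]_2, qnorm x = 0 -> x = 0.

Lemma anisotropic_3mod4 (F : finFieldType) :
  #|F| = 3 %[mod 4] -> anisotropic F.
Proof.
move=> F3 x /eqP; rewrite /qnorm addrC addr_eq0 => /eqP x2.
have [x0|x0] := eqVneq (x ord0 ord0) 0.
  apply: col2P; rewrite ?mxE //; apply/eqP.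
  by rewrite -sqrf_eq0 x2 x0 expr0n oppr0.
have /eqP[] := sqr_neqN1 (x ord_max ord0 / x ord0 ord0) F3.
by rewrite expr_div_n x2 mulNr divff // expf_neq0.
Qed.

(** Let [s = x + y = x' + y'] be nonzero. As the four points have the same norm,
    [x' - x], [x' - y] and [s] are pairwise orthogonal. In the plane this forces
    one of [x' - x] and [x' - y] to be parallel as well as orthogonal to [s],
    and such a vector is [0] by anisotropy. *)
Lemma few_coincidences_circle (F : finFieldType) (t : F) :
    odd #|F| -> anisotropic F ->
  few_coincidences [set x : 'cV[F]_2 | qnorm x == t].
Proof.
move=> F_odd anisoF x y; rewrite !inE => /eqP xt /eqP yt x' y'.
rewrite !inE => /eqP x't /eqP y't eq_s.
have [s0|s_neq0] := eqVneq (x + y) 0; first by constructor 3; rewrite -eq_s s0.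
have two_neq0 := odd_card_two_neq0 F_odd.
pose det2 (u v : 'cV[F]_2) :=
  u ord0 ord0 * v ord_max ord0 - u ord_max ord0 * v ord0 ord0.
(* Lagrange's identity: a vector both orthogonal and parallel to s is 0. *)
have det0 u : dot u (x + y) = 0 -> det2 u (x + y) = 0 -> u = 0.
  move=> us0 det0; apply/anisoF.
  have : qnorm u * qnorm (x + y) = dot u (x + y) ^+ 2 + det2 u (x + y) ^+ 2.
    by rewrite dot2E /det2 /qnorm; ring.
  rewrite us0 det0 expr0n addr0 => /eqP; rewrite mulf_eq0.
  by case/orP => /eqP // /anisoF /eqP; rewrite (negPf s_neq0).
have y'E : y' = x + y - x' by rewrite eq_s addrC addKr.
have halve z : 2 * z = 0 -> z = 0 :> F.
  by move/eqP; rewrite mulf_eq0 (negPf two_neq0) => /eqP.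
have ws : dot (x' - x) (x + y) = 0.
  apply: halve; transitivity (qnorm y - qnorm x - qnorm y' + qnorm x').
    by rewrite y'E dot2E /qnorm !mxE; ring.
  by rewrite xt yt x't y't; ring.
have zs : dot (x' - y) (x + y) = 0.
  apply: halve; transitivity (qnorm x - qnorm y - qnorm y' + qnorm x').
    by rewrite y'E dot2E /qnorm !mxE; ring.
  by rewrite xt yt x't y't; ring.
have wz : dot (x' - x) (x' - y) = 0.
  apply: halve; transitivity (qnorm x' + qnorm y' - qnorm x - qnorm y).
    by rewrite y'E dot2E /qnorm !mxE; ring.
  by rewrite xt yt x't y't; ring.
(* Cauchy-Binet: this product is a determinant of dot products. *)
have : det2 (x' - x) (x + y) * det2 (x' - y) (x + y) = 0.
  transitivity (dot (x' - x) (x' - y) * dot (x + y) (x + y)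
    - dot (x' - x) (x + y) * dot (x' - y) (x + y)).
    by rewrite !dot2E /det2; ring.
  by rewrite wz ws !mul0r subrr.
move/eqP; rewrite mulf_eq0 => /orP[] /eqP.
- move/(det0 _ ws)/eqP; rewrite subr_eq0 => /eqP x'x.
  by constructor 1; rewrite y'E x'x addrC addKr.
- move/(det0 _ zs)/eqP; rewrite subr_eq0 => /eqP x'y.
  by constructor 2; rewrite y'E x'y addrK.
Qed.

Lemma qnorm_trmx_O2 (F : finFieldType) (g : 'M[F]_2) m :
  odd #|F| -> g \in O2 F -> qnorm (g^T *m m) = qnorm m.
Proof.
move=> F_odd; rewrite O2E // => /eqP gTg.
have : g^T \in O2 F by rewrite O2E // trmxK (mulmx1C gTg).
by rewrite inE => /forallP/(_ m)/eqP.
Qed.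

(** A rotation ([d = 1]) or a reflection ([d = -1]) is known from its first
    column, because its transpose is both its inverse and [d] times its
    adjugate. *)
Lemma O2_second_column (F : finFieldType) (g : 'M[F]_2) :
    odd #|F| -> g \in O2 F ->
  let d := g ord0 ord0 * g ord_max ord_max - g ord0 ord_max * g ord_max ord0 in
  [/\ d ^+ 2 = 1, g ord0 ord_max = - d * g ord_max ord0
    & g ord_max ord_max = d * g ord0 ord0].
Proof.
move=> F_odd; rewrite O2E // => /eqP/matrixP gTg d.
have gE i j : g ord0 i * g ord0 j + g ord_max i * g ord_max j = (i == j)%:R.
  by have := gTg i j; rewrite !mxE sum_ord2 !mxE.
have h00 := gE ord0 ord0; have h01 := gE ord0 ord_max.
have h11 := gE ord_max ord_max.
rewrite /= in h00 h01 h11; rewrite /d.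
move: (g ord0 ord0) (g ord0 ord_max) (g ord_max ord0) (g ord_max ord_max)
  h00 h01 h11 {gTg gE d} => a b c e h00 h01 h11; split.
- transitivity ((a * a + c * c) * (b * b + e * e) - (a * b + c * e) ^+ 2).
    by ring.
  by rewrite h00 h01 h11; ring.
- transitivity (b * (a * a + c * c) - a * (a * b + c * e)); last by ring.
  by rewrite h00 h01 mulr1 mulr0 subr0.
- transitivity (e * (a * a + c * c) - c * (a * b + c * e)); last by ring.
  by rewrite h00 h01 mulr1 mulr0 subr0.
Qed.

(** For a given determinant, [g^T *m m = m'] is a linear system in the first
    column of [g] whose determinant is, up to sign, [qnorm m != 0]: at most one
    solution for each of the two signs. *)
Lemma card_O2_fiber_le2 (F : finFieldType) (m m' : 'cV[F]_2) :
    odd #|F| -> anisotropic F -> m != 0 ->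
  (#|[set g in O2 F | g^T *m m == m']| <= 2)%N.
Proof.
move=> F_odd anisoF m_neq0.
pose d (g : 'M[F]_2) :=
  g ord0 ord0 * g ord_max ord_max - g ord0 ord_max * g ord_max ord0.
rewrite -[leqRHS]card_bool; set G := [set g in O2 F | _].
suff d_inj : {in G &, injective (fun g => d g == 1)}.
  by rewrite -(card_in_imset d_inj) max_card.
move=> g h /setIdP[gO /eqP gm] /setIdP[hO /eqP hm] dgh.
have [dg2 g01 g11] := O2_second_column F_odd gO.
have [dh2 h01 h11] := O2_second_column F_odd hO.
rewrite -/(d g) in dg2 g01 g11; rewrite -/(d h) in dh2 h01 h11.
have dE : d h = d g.
  move/eqP: dg2; rewrite sqrf_eq1; move/eqP: dh2; rewrite sqrf_eq1.
  case/orP=> /eqP dhE /orP[] /eqP dgE; rewrite dhE dgE //.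
    by move: dgh; rewrite dhE dgE eqxx => /eqP.
  by move: dgh; rewrite dhE dgE eqxx => /esym/eqP.
rewrite dE in h01 h11.
have d_neq0 : d g != 0 by rewrite -sqrf_eq0 dg2 oner_eq0.
have qm_neq0 : qnorm m != 0 by apply: contraNN m_neq0 => /eqP /anisoF ->.
have /colP ghm : g^T *m m = h^T *m m by rewrite gm.
have := ghm ord0; have := ghm ord_max.
rewrite !mxE !sum_ord2 !mxE g01 g11 h01 h11 => /eqP e1 /eqP e0.
have {}e1 : g ord0 ord0 * m ord_max ord0 - g ord_max ord0 * m ord0 ord0 =
            h ord0 ord0 * m ord_max ord0 - h ord_max ord0 * m ord0 ord0.
  apply: (mulfI d_neq0); move/eqP: e1 => e1.
  by rewrite !mulrBr !mulrA addrC -!mulNr e1 addrC.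
move/eqP: e0 => e0.
have g00 : g ord0 ord0 = h ord0 ord0.
  apply/eqP; rewrite -subr_eq0 -(mulIr_eq0 _ (mulIf qm_neq0)) /qnorm.
  apply/eqP; transitivity (m ord0 ord0 *
       (g ord0 ord0 * m ord0 ord0 + g ord_max ord0 * m ord_max ord0
        - (h ord0 ord0 * m ord0 ord0 + h ord_max ord0 * m ord_max ord0))
     + m ord_max ord0 *
       (g ord0 ord0 * m ord_max ord0 - g ord_max ord0 * m ord0 ord0
        - (h ord0 ord0 * m ord_max ord0 - h ord_max ord0 * m ord0 ord0))).
    by ring.
  by rewrite e0 e1; ring.
have g10 : g ord_max ord0 = h ord_max ord0.
  apply/eqP; rewrite -subr_eq0 -(mulIr_eq0 _ (mulIf qm_neq0)) /qnorm.
  apply/eqP; transitivity (m ord_max ord0 *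
       (g ord0 ord0 * m ord0 ord0 + g ord_max ord0 * m ord_max ord0
        - (h ord0 ord0 * m ord0 ord0 + h ord_max ord0 * m ord_max ord0))
     - m ord0 ord0 *
       (g ord0 ord0 * m ord_max ord0 - g ord_max ord0 * m ord0 ord0
        - (h ord0 ord0 * m ord_max ord0 - h ord_max ord0 * m ord0 ord0))).
    by ring.
  by rewrite e0 e1; ring.
have ordE (k : 'I_2) : k = ord0 \/ k = ord_max.
  by case: k => [[|[|//]] k2]; [left | right]; apply: val_inj.
apply/matrixP => i j.
by case: (ordE i) (ordE j) => -> [] ->; rewrite ?g01 ?g11 ?h01 ?h11 ?g00 ?g10.
Qed.

(** * Coincidences of the difference sets *)

(** The second moment of the number of representations [z = a - g *m b]. *)
Definition coincidences (F : finFieldType) (A B : {set 'cV[F]_2})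
    (g : 'M[F]_2) : nat :=
  (\sum_(p in setX A B) \sum_(p' in setX A B)
    (p.1 - g *m p.2 == p'.1 - g *m p'.2)%R)%N.

Lemma card_le_diffset_coincidences (F : finFieldType) (A B : {set 'cV[F]_2}) g :
  ((#|A| * #|B|) ^ 2 <= #|diffset A g B| * coincidences A B g)%N.
Proof.
pose r z : nat := (\sum_(p in setX A B) (p.1 - g *m p.2 == z)%R)%N.
have r1 : (\sum_(z in diffset A g B) r z = #|A| * #|B|)%N.
  rewrite -cardsX -sum1_card /r exchange_big /=.
  apply: eq_bigr => -[a b] /setXP[aA bB] /=.
  rewrite (bigD1 (a - g *m b)%R) /=; last by apply/imset2P; exists a b.
  by rewrite eqxx big1 // => z /andP[_ /negPf]; rewrite eq_sym => ->.
have r2 : (\sum_(z in diffset A g B) r z ^ 2 = coincidences A B g)%N.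
  transitivity (\sum_(z in diffset A g B) \sum_(p in setX A B)
     \sum_(p' in setX A B)
       (p.1 - g *m p.2 == z)%R * (p'.1 - g *m p'.2 == z)%R)%N.
    by apply: eq_bigr => z _; rewrite -mulnn big_distrlr.
  rewrite exchange_big /=; apply: eq_bigr => -[a b] /setXP[aA bB] /=.
  rewrite exchange_big /=; apply: eq_bigr => p' _.
  rewrite (bigD1 (a - g *m b)%R) /=; last by apply/imset2P; exists a b.
  rewrite eqxx mul1n eq_sym big1 ?addn0 // => z /andP[_ /negPf].
  by rewrite eq_sym => ->.
have := @sum_mul_sqr_le int _ (mem (diffset A g B)) (fun=> 1)
  (fun z => (r z)%:R).
move=> /(_ (fun=> rpred1 _) (fun z => realn _ (r z))).
under eq_bigr do rewrite mul1r.
under [X in _ <= X * _ -> _]eq_bigr do rewrite expr1n.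
under [X in _ <= _ * X -> _]eq_bigr do rewrite -natrX.
by rewrite sumr_const -!natr_sum r1 r2 -natrX -natrM ler_nat.
Qed.

(** Parseval for the representation function, whose Fourier transform at [m] is
    [exp_sum psi A m] times the conjugate of [exp_sum psi B (g^T *m m)]. *)
Lemma coincidences_fourier (F : finFieldType) (psi : F -> algC)
    (A B : {set 'cV[F]_2}) g :
    additive_character psi ->
  (#|F| ^ 2 * coincidences A B g)%:R =
  \sum_m `|exp_sum psi A m| ^+ 2 * `|exp_sum psi B (g^T *m m)| ^+ 2.
Proof.
move=> psiP; have [psiD _ _] := psiP.
have := parseval psiP (mem (setX A B)) (fun=> 1) (fun p => p.1 - g *m p.2).
rewrite card_mx muln1 natrM natr_sum => parse; transitivity
  (\sum_x `|\sum_(p in setX A B) 1 * psi (dot (p.1 - g *m p.2) x)| ^+ 2).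
  rewrite parse; congr (_ * _); apply: eq_bigr => p _.
  by rewrite natr_sum; apply: eq_bigr => p' _; rewrite conjC1 !mulr1.
apply: eq_bigr => m _; rewrite -exprMn -[`|exp_sum psi B _|]norm_conjC -normrM.
congr (`|_| ^+ 2); rewrite /exp_sum rmorph_sum big_distrlr /=.
rewrite pair_big /=; apply: eq_big => [[a b]|[a b] _] /=.
  by rewrite in_setX.
rewrite mul1r -additive_characterN // -psiD; congr psi.
by rewrite dotC dotDr dotNr dot_mulmx.
Qed.

(** The frequency [0] contributes exactly [(#|A| * #|B|) ^ 2] to each [g]. For
    the others, sort the pairs [(m, g)] by [m' = g^T *m m]: each [m'] is reached
    at most twice from each [m], and only from the circle through [m'].
    Restriction to this circle bounds the sum over [m], then Parseval for [B] the sum over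
    [m']. Squaring keeps the bound an inequality between natural numbers. *)
Lemma excess_coincidences_le (F : finFieldType) (A B : {set 'cV[F]_2})
    (E : {set 'M[F]_2}) :
    odd #|F| -> anisotropic F -> E \subset O2 F ->
  ((\sum_(g in E) (#|F| ^ 2 * coincidences A B g - (#|A| * #|B|) ^ 2)) ^ 2
    <= 12 * #|F| ^ 6 * #|A| ^ 3 * #|B| ^ 2)%N.
Proof.
move=> F_odd anisoF EO; have [psi psiP] := additive_character_exists F.
pose a m := `|exp_sum psi A m| ^+ 2; pose b m := `|exp_sum psi B m| ^+ 2.
have a_ge0 m : 0 <= a m by rewrite exprn_ge0.
have b_ge0 m : 0 <= b m by rewrite exprn_ge0.
have exp_sum0 (S : {set 'cV[F]_2}) : exp_sum psi S 0 = #|S|%:R.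
  rewrite /exp_sum; under eq_bigr do rewrite dot0l (additive_character0 psiP).
  by rewrite sumr_const.
have excessE g : (#|F| ^ 2 * coincidences A B g - (#|A| * #|B|) ^ 2)%N%:R
    = \sum_(m | m != 0) a m * b (g^T *m m) :> algC.
  have := coincidences_fourier A B g psiP.
  rewrite (bigD1 0) //= mulmx0 !exp_sum0 !normr_nat -exprMn -natrM -natrX => cE.
  move: (#|F| ^ 2 * _)%N ((#|A| * #|B|) ^ 2)%N cE => u v uE.
  have le_vu : (v <= u)%N.
    rewrite -(ler_nat algC) uE lerDl sumr_ge0 // => m _.
    by rewrite mulr_ge0 ?exprn_ge0.
  by rewrite natrB // uE addrC addrK.
(* The restriction bound, common to all the circles. *)
pose M : algC := sqrtC (3 * #|F| ^ 2 * #|A| ^ 3)%:R.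
have M_ge0 : 0 <= M by rewrite sqrtC_ge0 ler0n.
have a_circle t : \sum_(m in [set x | qnorm x == t]) a m <= M.
  rewrite -(ler_pXn2r (ltn0Sn 1)) ?nnegrE ?sumr_ge0 // sqrtCK.
  have := restriction psiP A (few_coincidences_circle (t := t) F_odd anisoF).
  by rewrite card_mx muln1.
rewrite -(ler_nat algC) natrX natr_sum; under eq_bigr do rewrite excessE.
apply: (@le_trans _ _ ((2 * M * (#|F| ^ 2 * #|B|)%:R) ^+ 2)); last first.
  rewrite !exprMn sqrtCK -!natrX -!natrM ler_nat.
  by rewrite leq_eqVlt; apply/orP; left; apply/eqP; ring.
rewrite lerXn2r ?nnegrE ?mulr_ge0 ?ler0n //.
  by rewrite sumr_ge0 // => g _; rewrite sumr_ge0 // => m _; rewrite mulr_ge0.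
have bE : (#|F| ^ 2 * #|B|)%:R = \sum_m b m.
  by rewrite (exp_sum_parseval psiP) card_mx muln1.
rewrite bE mulr_sumr.
apply: (@le_trans _ _ (\sum_(m | m != 0) \sum_m'
   (\sum_(g in E) (g^T *m m == m')%:R) * (a m * b m'))).
  rewrite exchange_big /=; apply: ler_sum => m _.
  under [leRHS]eq_bigr do rewrite mulr_suml.
  rewrite [leRHS]exchange_big /=; apply: ler_sum => g _.
  rewrite (bigD1 (g^T *m m)) //= eqxx mul1r lerDl sumr_ge0 // => m' _.
  by rewrite !mulr_ge0 ?ler0n.
rewrite exchange_big /=; apply: ler_sum => m' _.
apply: (@le_trans _ _
  (\sum_(m in [set x | qnorm x == qnorm m']) 2 * (a m * b m'))).
  rewrite big_mkcond [leRHS]big_mkcond /=; apply: ler_sum => m _; rewrite inE.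
  have [->|m_neq0] /= := eqVneq m 0.
    by case: ifP => _ //; rewrite !mulr_ge0.
  case: eqVneq => [_|neq_q]; last first.
    rewrite big1 ?mul0r // => g gE; case: eqP => // gm.
    by move: neq_q; rewrite -gm qnorm_trmx_O2 ?eqxx // (subsetP EO).
  rewrite ler_wpM2r ?mulr_ge0 //.
  rewrite -natr_sum ler_nat.
  apply: leq_trans (card_O2_fiber_le2 m' F_odd anisoF m_neq0).
  rewrite -big_mkcondr sum1_card; apply: subset_leq_card.
  apply/subsetP => g; rewrite !inE => /andP[/(subsetP EO)].
  by rewrite inE => -> ->.
rewrite -mulr_sumr -mulr_suml mulrA ler_wpM2r // ler_wpM2l ?ler0n //.
Qed.

(** * The exceptional set *)

Theorem theorem7p3 (R : realType) :
  exists C c : R, 0 < C /\ 0 < c /\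
  forall (eps : R) (F : finFieldType) (q : nat) (A B : {set 'cV[F]_2}),
    0 < eps ->
    #|F| = q -> odd q -> q = 3 %[mod 4] ->
    (0 < #|A|)%N -> (#|A| <= #|B|)%N ->
    #|B|%:R `^ (1 + eps) < q%:R ^+ 2 / 2 ->
    exists E : {set 'M[F]_2},
      [/\ E \subset O2 F,
          #|E|%:R <= C * (q%:R * #|B|%:R `^ eps / #|A|%:R `^ (1 / 2)) &
          forall g : 'M[F]_2, g \in O2 F :\: E ->
            c * #|B|%:R `^ (1 + eps) <= #|diffset A g B|%:R].
Proof.
exists 8, 1; split=> //; split=> // eps F q A B eps_gt0 Fq q_odd q3 A_gt0 leAB.
set N : R := _ `^ (1 + eps) => N_lt.
pose E := [set g in O2 F | #|diffset A g B|%:R < N].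
have EO : E \subset O2 F by apply/subsetP => g /setIdP[].
exists E; split=> // [|g]; last first.
  rewrite inE => /andP[gE gO]; rewrite mul1r leNgt.
  by apply: contraNN gE => ?; apply/setIdP.
have B_gt0 : (0 < #|B|)%N by apply: leq_trans leAB.
have F_odd : odd #|F| by rewrite Fq.
have anisoF : anisotropic F by apply: anisotropic_3mod4; rewrite Fq.
have := excess_coincidences_le A B F_odd anisoF EO; rewrite Fq.
set D : nat := (\sum_(g in E) _)%N => D_le.
pose r : R := #|A|%:R `^ (1 / 2); pose b : R := #|B|%:R; pose P := b `^ eps.
have r_gt0 : 0 < r by rewrite /r powR_gt0 ?ltr0n.
have b_gt0 : 0 < b by rewrite ltr0n.
have q_gt0 : 0 < q%:R :> R by rewrite ltr0n -Fq; apply/card_gt0P; exists 0.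
have rA : #|A|%:R = r ^+ 2 by rewrite /r div1r powR12_sqrt ?sqr_sqrtr ?ler0n.
have NE : N = b * P.
  by rewrite /N powRD ?powRr1 ?ler0n //; apply/implyP => _; rewrite gt_eqF.
have N_gt0 : 0 < N by rewrite /N powR_gt0 ?ltr0n.
(* The constant 4 comes from 12 <= 4 ^ 2. *)
have D_le' : D%:R <= 4 * q%:R ^+ 3 * r ^+ 3 * b.
  rewrite -(ler_pXn2r (ltn0Sn 1)) ?nnegrE ?ler0n //; last first.
    by rewrite !mulr_ge0 ?exprn_ge0 // ltW.
  apply: (@le_trans _ _ (12 * q%:R ^+ 6 * (r ^+ 2) ^+ 3 * b ^+ 2)).
    by rewrite -rA -!natrX -!natrM ler_nat.
  have -> : (4 * q%:R ^+ 3 * r ^+ 3 * b) ^+ 2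
    = 16 * q%:R ^+ 6 * (r ^+ 2) ^+ 3 * b ^+ 2 by ring.
  by rewrite !ler_wpM2r ?exprn_ge0 ?ler_nat // ltW.
(* For g in E there are more than (|A||B|)^2 / N coincidences, while the part
   from the frequency 0 is, as N < q^2 / 2, at most half as large. *)
have ND : #|E|%:R * (q%:R ^+ 2 * (r ^+ 2 * b) ^+ 2 / 2) <= N * D%:R.
  rewrite -sum1_card !natr_sum mulr_sumr mulr_suml; apply: ler_sum => g.
  case/setIdP=> gO g_lt; rewrite mul1r.
  have := card_le_diffset_coincidences A B g.
  rewrite -(ler_nat R) natrX !natrM rA -/b.
  set v := (X in X <= _); set Q := (coincidences _ _ _)%:R => vQ.
  have v_ge0 : 0 <= v by rewrite exprn_ge0 // mulr_ge0 ?exprn_ge0 // ltW.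
  have NQ : v <= N * Q.
    by apply: le_trans vQ _; rewrite ler_wpM2r ?ler0n // ltW.
  have natB (u w : nat) : u%:R - w%:R <= (u - w)%N%:R :> R.
    by rewrite lerBlDr -natrD ler_nat addnC -leq_subLR.
  have := natB (q ^ 2 * coincidences A B g)%N ((#|A| * #|B|) ^ 2)%N.
  rewrite (natrM _ (q ^ 2)%N) (natrX _ q) (natrX _ (#|A| * #|B|)) natrM rA.
  rewrite -/b -/v -/Q.
  move=> /(ler_wpM2l (ltW N_gt0)); apply: le_trans.
  have q2_ge0 : 0 <= q%:R ^+ 2 :> R by rewrite exprn_ge0 // ltW.
  have := ler_wpM2l q2_ge0 NQ; have := ler_wpM2r v_ge0 (ltW N_lt); lra.
rewrite -/r -/b -/P mulrA ler_pdivlMr //.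
have k_gt0 : 0 < q%:R ^+ 2 * r ^+ 3 * b ^+ 2 / 2.
  by rewrite !mulr_gt0 ?exprn_gt0 // invr_gt0.
rewrite -(ler_pM2r k_gt0).
have -> : #|E|%:R * r * (q%:R ^+ 2 * r ^+ 3 * b ^+ 2 / 2) =
    #|E|%:R * (q%:R ^+ 2 * (r ^+ 2 * b) ^+ 2 / 2) by field.
have -> : 8 * (q%:R * P) * (q%:R ^+ 2 * r ^+ 3 * b ^+ 2 / 2) =
    N * (4 * q%:R ^+ 3 * r ^+ 3 * b) by rewrite NE; field.
by apply: le_trans ND _; rewrite ler_wpM2l // ltW.
Qed.
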